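(* For any finite simple graphs $G$ and $H$, $$\gamma(G)\,\gamma(H) \leq \gamma_R(G\square H),$$ where $\gamma$ denotes the domination number, $\gamma_R$ denotes the Roman domination number, and $G\square H$ denotes the Cartesian product of $G$ and $H$.
   Context: All graphs are finite and simple. Let $G=(V,E)$ be a graph. A set $S\subseteq V$ is a dominating set of $G$ if every vertex not in $S$ is adjacent to a vertex in $S$. The domination number $\gamma(G)$ is the minimum cardinality of a dominating set of $G$. A Roman dominating function (RDF) on $G$ is a function $f: V\rightarrow\{0,1,2\}$ such that every vertex $u$ with $f(u)=0$ is adjacent to at least one vertex $v$ with $f(v)=2$. The weight of $f$ is $f(V(G))=\sum_{v\in V}f(v)$. The Roman domination number $\gamma_R(G)$ is the minimum weight of an RDF on $G$. The Cartesian product $G\square H$ of graphs $G$ and $H$ is the graph with vertex set $V(G)\times V(H)$ in which two vertices are adjacent if and only if they are equal in one coordinate and adjacent in the other. *)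

(* Defs.v *)
From mathcomp Require Import all_boot.

Set Implicit Arguments.
Unset Strict Implicit.
Unset Printing Implicit Defensive.

(* The vertex set may be empty. *)
Record sgraph := SGraph {
  vertex :> finType;
  adj : rel vertex;
  adj_sym : symmetric adj;
  adj_irrefl : irreflexive adj }.

Definition dominating (G : sgraph) (S : {set G}) : bool :=
  [forall v, (v \notin S) ==> [exists u in S, adj v u]].

Lemma dominatingT (G : sgraph) : dominating [set: G].
Proof. by apply/forallP => v; rewrite inE. Qed.

(* [arg min] takes a feasible starting point, here the full vertex set; the
   minimum does not depend on it (domination_numberP). *)
Definition domination_number (G : sgraph) : nat :=
  #|[arg min_(S < [set: G] | dominating S) #|S|]|.

Lemma domination_numberP (G : sgraph) :
  (exists2 S : {set G}, dominating S & #|S| = domination_number G) /\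
  (forall S : {set G}, dominating S -> domination_number G <= #|S|).
Proof.
rewrite /domination_number; case: arg_minnP => [|S domS minS].
  exact: dominatingT.
by split; first exists S.
Qed.

Definition roman_dominating (G : sgraph) (f : {ffun G -> 'I_3}) : bool :=
  [forall u, (f u == 0 :> nat) ==> [exists v, adj u v && (f v == 2 :> nat)]].

Definition weight (G : sgraph) (f : {ffun G -> 'I_3}) : nat := \sum_v f v.

(* ord_max : 'I_3 is the value 2. *)
Definition const2 (G : sgraph) : {ffun G -> 'I_3} := [ffun=> ord_max].

Lemma roman_dominating_const2 (G : sgraph) : roman_dominating (const2 G).
Proof. by apply/forallP => v; rewrite ffunE. Qed.

Definition roman_domination_number (G : sgraph) : nat :=
  weight [arg min_(f < const2 G | roman_dominating f) weight f].

Lemma roman_domination_numberP (G : sgraph) :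
  (exists2 f : {ffun G -> 'I_3},
     roman_dominating f & weight f = roman_domination_number G) /\
  (forall f : {ffun G -> 'I_3},
     roman_dominating f -> roman_domination_number G <= weight f).
Proof.
rewrite /roman_domination_number; case: arg_minnP => [|f domf minf].
  exact: roman_dominating_const2.
by split; first exists f.
Qed.

Definition cart_adj (G H : sgraph) : rel (G * H) := fun x y =>
  (x.1 == y.1) && adj x.2 y.2 || (x.2 == y.2) && adj x.1 y.1.

Lemma cart_adj_sym (G H : sgraph) : symmetric (@cart_adj G H).
Proof.
move=> x y; rewrite /cart_adj (eq_sym x.1) (eq_sym x.2).
by rewrite (adj_sym x.1) (adj_sym x.2).
Qed.

Lemma cart_adj_irrefl (G H : sgraph) : irreflexive (@cart_adj G H).
Proof. by move=> x; rewrite /cart_adj !adj_irrefl !andbF. Qed.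

Definition cart_prod (G H : sgraph) : sgraph :=
  SGraph (@cart_adj_sym G H) (@cart_adj_irrefl G H).

(* Main.v *)
Require Import Defs.
From mathcomp Require Import all_boot.

(** The proof is a double count in the style of Clark and Suen.  Let [S] be a
    minimum dominating set of [G] and let [p] send each vertex of [G] to a
    member of [S] that is equal or adjacent to it; the fibres of [p] cut [G]
    into [#|S|] cells.  Let [f] be a minimum Roman dominating function on the
    product, [V1] and [V2] its level sets.

    For [u] in [S], let [P u] be the projection to [H] of the vertices of
    positive value lying over the cell of [u] ([shadow]).  Adding to [P u] the
    set [L u] of the vertices that it leaves undominated gives a dominating set
    of [H], so [domination_number H <= #|P u| + #|L u|].  Summing over [u],
    [domination_number G * domination_number H] is at most
    [#|V1| + #|V2| + \sum_u #|L u|], because a vertex of the product lies over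
    only one cell ([sum_card_shadow]).

    It remains to see that the pairs [(u, h)] with [h \in L u] number at most
    [#|V2|].  If [h \in L u], then over the cell of [u] the function [f]
    vanishes at height [h] and at all the neighbours of [h], so the vertices of
    the cell can only be defended inside the layer of height [h], by vertices of
    value 2.  Hence, in that layer, the members [u] of [S] with [h \in L u] can
    be exchanged for the vertices of value 2 and [G] stays dominated.  As [S] is
    minimum, the exchange cannot lower the cardinality
    ([roman_layer_bound]).  The total is [#|V1| + 2 * #|V2|], the weight of
    [f]. *)

Set Implicit Arguments.
Unset Strict Implicit.
Unset Printing Implicit Defensive.

Definition undominated (G : sgraph) (S : {set G}) : {set G} :=
  [set v | (v \notin S) && [forall u in S, ~~ adj v u]].

Lemma domination_number_le_undominated (G : sgraph) (S : {set G}) :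
  domination_number G <= #|S| + #|undominated S|.
Proof.
have [_ minG] := domination_numberP G.
apply: leq_trans (minG (S :|: undominated S) _) (leq_card_setU _ _).
apply/forallP => v; apply/implyP.
rewrite !inE negb_or negb_and => /andP[vS]; rewrite vS /=.
case/forall_inPn => u uS; rewrite negbK => vu.
by apply/exists_inP; exists u; rewrite // inE uS.
Qed.

Lemma dominator_exists (G : sgraph) (S : {set G}) : dominating S ->
  exists p : G -> G, forall v, p v \in S /\ (p v = v \/ adj v (p v)).
Proof.
move=> /forallP domS.
exists (fun v => if v \in S then v else odflt v [pick u in S | adj v u]) => v.
case: ifPn => [vS | vS]; first by split; last left.
case: pickP => [u /andP[uS vu] | noneS]; first by split; last right.
have /existsP[u] := implyP (domS v) vS.
by rewrite noneS.
Qed.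

Lemma exchange_sum_card (I J : finType) (A : {pred I}) (F : I -> {set J}) :
  \sum_(i in A) #|F i| = \sum_j #|[set i in A | j \in F i]|.
Proof.
under eq_bigr do rewrite -sum1_card big_mkcond.
rewrite exchange_big; apply: eq_bigr => j _.
by rewrite -sum1dep_card [RHS]big_mkcondr.
Qed.

Section Layers.

Variables (G H : sgraph) (f : {ffun cart_prod G H -> 'I_3}) (p : G -> G).

Definition shadow (u : G) : {set H} :=
  [set h | [exists g, (p g == u) && (f (g, h) != 0 :> nat)]].

Lemma mem_shadow (g : G) (h : H) : f (g, h) != 0 :> nat -> h \in shadow (p g).
Proof. by move=> fgh; rewrite inE; apply/existsP; exists g; rewrite eqxx. Qed.

(** A vertex of positive value is charged only by the cell over which it
    lies. *)
Lemma sum_card_shadow (S : {set G}) :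
  \sum_(u in S) #|shadow u| <= #|[set x | f x != 0 :> nat]|.
Proof.
pose over u := [set x : G * H | (p x.1 == u) && (f x != 0 :> nat)].
have le_shadow u : #|shadow u| <= #|over u|.
  apply: leq_trans (leq_imset_card snd (over u)).
  apply: subset_leq_card; apply/subsetP => h.
  rewrite inE => /existsP[g gh]; apply/imsetP.
  by exists (g, h) => //; rewrite inE.
apply: (@leq_trans (\sum_u #|over u|)).
  apply: (@leq_trans (\sum_(u in S) #|over u|)).
    by apply: leq_sum => u _.
  by rewrite [leqRHS](bigID (mem S)) leq_addr.
rewrite -[leqRHS]sum1dep_card (partition_big (fun x => p x.1) predT) //=.
apply: leq_sum => u _; rewrite -sum1dep_card.
by apply/eq_leq/eq_bigl => x; rewrite andbC.
Qed.

Hypothesis romf : roman_dominating f.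

(** The vertical neighbours of a vertex over the cell of [u] lie over the same
    cell, so at an undominated height they all have value 0 and the defender
    is horizontal. *)
Lemma undominated_horizontal (g : G) (h : H) :
  h \in undominated (shadow (p g)) ->
  exists2 g', adj g g' & f (g', h) = 2 :> nat.
Proof.
rewrite inE => /andP[hP /forall_inP nadj].
have fgh0 : f (g, h) == 0 :> nat by apply: contraR hP; apply: mem_shadow.
have /existsP[[g' h'] /andP[/orP[]/andP[/eqP/= eq_gh adj_gh] /eqP f2]] :=
  implyP (forallP romf (g, h)) fgh0.
  have /nadj : h' \in shadow (p g) by apply: mem_shadow; rewrite eq_gh f2.
  by rewrite adj_gh.
by exists g'; rewrite // eq_gh.
Qed.

Variable S : {set G}.
Hypothesis pS : forall v, p v \in S /\ (p v = v \/ adj v (p v)).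
Hypothesis minS : #|S| = domination_number G.

(** The exchange step: trading the members of [S] whose cell needs horizontal
    defence for the vertices of value 2 in the layer keeps [G] dominated. *)
Lemma roman_layer_bound (h : H) :
  #|[set u in S | h \in undominated (shadow u)]|
    <= #|[set g | f (g, h) == 2 :> nat]|.
Proof.
set B := [set u in S | _]; set D := [set g | _].
have domE : dominating (D :|: S :\: B).
  apply/forallP => v; apply/implyP => vE; apply/exists_inP.
  have [pvS v_pv] := pS v.
  case: (boolP (h \in undominated (shadow (p v)))) => hv.
    have [g vg fg2] := undominated_horizontal hv.
    by exists g; rewrite // !inE fg2.
  have pvE : p v \in D :|: S :\: B.
    by rewrite 3!inE pvS [p v \in B]inE pvS hv orbT.
  case: v_pv => [pv_v | vpv]; last by exists (p v).
  by rewrite -pv_v pvE in vE.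
have := leq_trans ((domination_numberP G).2 _ domE) (leq_card_setU _ _).
have BS : B \subset S by apply/subsetP => u; rewrite inE => /andP[].
by rewrite -minS -(cardsID B S) (setIidPr BS) leq_add2r.
Qed.

Lemma sum_card_undominated :
  \sum_(u in S) #|undominated (shadow u)| <= #|[set x | f x == 2 :> nat]|.
Proof.
rewrite exchange_sum_card.
apply: (@leq_trans (\sum_h #|[set g | f (g, h) == 2 :> nat]|)).
  by apply: leq_sum => h _; apply: roman_layer_bound.
under eq_bigr do rewrite -sum1dep_card big_mkcond.
rewrite exchange_big pair_bigA -sum1dep_card [leqRHS]big_mkcond.
by apply/eq_leq/eq_bigr => -[].
Qed.

End Layers.

(** A vertex of value 2 is counted in both sets: once to pay for the shadows,
    once for the undominated heights. *)
Lemma weight_level_sets (G : sgraph) (f : {ffun G -> 'I_3}) :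
  weight f = #|[set x | f x != 0 :> nat]| + #|[set x | f x == 2 :> nat]|.
Proof.
rewrite -!sum1dep_card [X in X + _]big_mkcond [X in _ + X]big_mkcond -big_split.
by apply: eq_bigr => x _; case: (f x) => [[|[|[|]]]].
Qed.

Theorem theorem2 (G H : sgraph) :
  domination_number G * domination_number H
    <= roman_domination_number (cart_prod G H).
Proof.
have [[S domS minS] _] := domination_numberP G.
have [[f romf <-] _] := roman_domination_numberP (cart_prod G H).
have [p pS] := dominator_exists domS.
rewrite weight_level_sets -minS -sum_nat_const.
apply: leq_trans (leq_add (sum_card_shadow f p S)
                          (sum_card_undominated romf pS minS)).
rewrite -big_split; apply: leq_sum => u _.
exact: domination_number_le_undominated.
Qed.
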